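(* Let $\mathbb{K}=\mathbb{R}$ or $\mathbb{C}$, and let $A=\begin{pmatrix}a&0\\0&b\end{pmatrix}$, $B=\begin{pmatrix}c&0\\0&d\end{pmatrix}$ with $a,b,c,d\in\mathbb{K}$. Consider the system $XAX=BXB$, $XBX=AXA$ for $X\in M_2(\mathbb{K})$. (i) When $a=0$ and $b,c,d\neq0$, the only non-trivial solution to the system is $X=\begin{pmatrix}0&0\\0&\frac{d^2}{b}\end{pmatrix}$, where $b^3=d^3$. (ii) Similarly, when $b=0$ and $a,c,d\neq0$, the only non-trivial solution is $X=\begin{pmatrix}\frac{c^2}{a}&0\\0&0\end{pmatrix}$.
   Context: $M_2(\mathbb{K})$ denotes the $2\times2$ matrices over $\mathbb{K}$. A solution is non-trivial if it is not the zero matrix. *)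

(* Defs.v *)
From HB Require Import structures.
From mathcomp Require Import all_boot all_order all_algebra.
From mathcomp Require Import reals.
From mathcomp Require Import complex.
Set Implicit Arguments.
Unset Strict Implicit.
Unset Printing Implicit Defensive.
Import Order.TTheory GRing.Theory Num.Theory.
Local Open Scope ring_scope.

Definition mx2 (K : fieldType) (p q r s : K) : 'M[K]_2 :=
  \matrix_(i < 2, j < 2) (nth [::] [:: [:: p; q]; [:: r; s]] i)`_j.

Definition is_solution (K : fieldType) (A B X : 'M[K]_2) : Prop :=
  X *m A *m X = B *m X *m B /\ X *m B *m X = A *m X *m A.

(* Main.v *)
Require Import Defs.
From HB Require Import structures.
From mathcomp Require Import all_boot all_order all_algebra.
From mathcomp Require Import reals.
From mathcomp Require Import complex.
From mathcomp Require Import ring.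
Set Implicit Arguments.
Unset Strict Implicit.
Unset Printing Implicit Defensive.
Import Order.TTheory GRing.Theory Num.Theory.
Local Open Scope ring_scope.

(* Over any field, write X = [[x, y], [z, w]] and let a = 0.  If y or z is
   nonzero, the off-diagonal equations force b w = c d and c x + d w = 0, the
   (2,2) entry of XAX = BXB then gives c = d, hence x = - w, and the (1,1) and
   (2,2) entries of XBX = AXA become d (w^2 + y z) = 0 and
   d (w^2 + y z) = b^2 w, contradicting w <> 0.  So X is diagonal, x = 0, and
   w is a nonzero root of b w^2 = d^2 w and d w^2 = b^2 w.  The case b = 0 is the
   same with the two coordinates exchanged. *)

Section EntrywiseSystem.
Variable K : fieldType.
Implicit Types (a b c d p q r s x y z w : K).

Lemma mx2_eqP p q r s p' q' r' s' :
  mx2 p q r s = mx2 p' q' r' s' <-> [/\ p = p', q = q', r = r' & s = s'].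
Proof.
split=> [/matrixP e | [-> -> -> ->] //].
by split; [move: (e 0 0)|move: (e 0 1)|move: (e 1 0)|move: (e 1 1)]; rewrite !mxE.
Qed.

Lemma mx2_entries (X : 'M[K]_2) : X = mx2 (X 0 0) (X 0 1) (X 1 0) (X 1 1).
Proof.
apply/matrixP=> i j; rewrite !mxE.
by case: i => [[|[|i]] ?] //; case: j => [[|[|j]] ?] //=; congr (X _ _); apply: val_inj.
Qed.

Lemma mx2_0 : (0 : 'M[K]_2) = mx2 0 0 0 0.
Proof. by rewrite [LHS]mx2_entries !mxE. Qed.

Lemma mul_mx2 p q r s p' q' r' s' :
  mx2 p q r s *m mx2 p' q' r' s' =
  mx2 (p * p' + q * r') (p * q' + q * s') (r * p' + s * r') (r * q' + s * s').
Proof.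
by rewrite [LHS]mx2_entries !mxE !big_ord_recl !big_ord0 /= !mxE /= !addr0.
Qed.

(** The entries of one matrix equation; exchanging [(a, b)] with [(c, d)] gives the other one. *)
Definition entry_system a b c d x y z w : Prop :=
  [/\ a * x ^+ 2 + b * (y * z) = c ^+ 2 * x,
       y * (a * x + b * w) = c * d * y,
       z * (a * x + b * w) = c * d * z &
       a * (y * z) + b * w ^+ 2 = d ^+ 2 * w].

Lemma sandwich_mx2P a b c d x y z w :
  mx2 x y z w *m mx2 a 0 0 b *m mx2 x y z w =
    mx2 c 0 0 d *m mx2 x y z w *m mx2 c 0 0 d <->
  entry_system a b c d x y z w.
Proof.
rewrite !mul_mx2 mx2_eqP; split=> -[e1 e2 e3 e4]; split.
all: first [apply: etrans (etrans _ e1) _; ring | apply: etrans (etrans _ e2) _; ring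
       | apply: etrans (etrans _ e3) _; ring | apply: etrans (etrans _ e4) _; ring].
Qed.

(** Conjugation by the permutation matrix of the two coordinates; it reduces the case b = 0 to the
    case a = 0. *)
Lemma entry_system_swap a b c d x y z w :
  entry_system a b c d x y z w <-> entry_system b a d c w z y x.
Proof.
have swap a' b' c' d' x' y' z' w' :
    entry_system a' b' c' d' x' y' z' w' -> entry_system b' a' d' c' w' z' y' x'.
  move=> [e1 e2 e3 e4]; split.
  - by rewrite -e4; ring.
  - by rewrite [d' * c']mulrC -e3; ring.
  - by rewrite [d' * c']mulrC -e2; ring.
  - by rewrite -e1; ring.
by split; exact: swap.
Qed.

Lemma is_solution_mx2P a b c d x y z w :
  is_solution (mx2 a 0 0 b) (mx2 c 0 0 d) (mx2 x y z w) <->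
  entry_system a b c d x y z w /\ entry_system c d a b x y z w.
Proof. by rewrite /is_solution !sandwich_mx2P. Qed.

(** The equations carrying [y] and those carrying [z] have the same shape, so [t] stands for either
    off-diagonal entry. *)
Lemma offdiag_eq0 b c d x y z w t : b != 0 -> c != 0 -> d != 0 ->
  entry_system 0 b c d x y z w -> entry_system c d 0 b x y z w ->
  t * (0 * x + b * w) = c * d * t -> t * (c * x + d * w) = 0 * b * t -> t = 0.
Proof.
move=> b0 c0 d0 [_ _ _ e4] [f1 _ _ f4] g h; apply/eqP/negPn/negP => t0.
have bw : b * w = c * d by apply: (mulfI t0); rewrite [RHS]mulrC -g; ring.
have cx : c * x = - (d * w).
  by move/eqP: h; rewrite !mul0r mulf_eq0 (negPf t0) addr_eq0 => /eqP.
have w0 : w != 0.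
  by apply: contraNneq (mulf_neq0 c0 d0) => w_eq0; rewrite -bw w_eq0 mulr0.
have cd : c = d.
  by apply: (mulIf d0); rewrite -bw; apply: (mulIf w0); rewrite -expr2 -e4; ring.
have xw : x = - w by apply: (mulfI c0); rewrite cx cd mulrN.
(* With c = d and x = - w, the left sides of [f1] and [f4] are both d (w^2 + y z), and the right
   side of [f1] vanishes. *)
have : b ^+ 2 * w = 0.
  by rewrite -f4; apply: etrans (etrans _ f1) _; rewrite ?xw ?cd; ring.
by apply/eqP; rewrite mulf_neq0 ?expf_neq0.
Qed.

Lemma entry_systems_solution b c d x y z w : b != 0 -> c != 0 -> d != 0 ->
  ((entry_system 0 b c d x y z w /\ entry_system c d 0 b x y z w) /\
     ~ [/\ x = 0, y = 0, z = 0 & w = 0]) <->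
  (b ^+ 3 = d ^+ 3 /\ [/\ x = 0, y = 0, z = 0 & w = d ^+ 2 / b]).
Proof.
move=> b0 c0 d0; split=> [[[E F] nz] | [bd [-> -> -> ->]]].
  have y0 : y = 0.
    by case: (E) (F) => [_ g _ _] [_ h _ _]; exact: (offdiag_eq0 b0 c0 d0 E F g h).
  have z0 : z = 0.
    by case: (E) (F) => [_ _ g _] [_ _ h _]; exact: (offdiag_eq0 b0 c0 d0 E F g h).
  case: E F nz => [e1 _ _ e4] [_ _ _ f4]; rewrite y0 z0 in e1 e4 f4 *.
  have x0 : x = 0 by apply: (mulfI (expf_neq0 2 c0)); rewrite -e1; ring.
  move=> nz; have w0 : w != 0 by apply/eqP=> w_eq0; apply: nz.
  have bw : b * w = d ^+ 2 by apply: (mulIf w0); rewrite -e4; ring.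
  have dw : d * w = b ^+ 2 by apply: (mulIf w0); rewrite -f4; ring.
  (* Both cubes equal b d w. *)
  split; first by rewrite exprS -dw [RHS]exprS -bw; ring.
  by split=> //; rewrite -bw mulrAC divff ?mul1r.
split; last by case=> _ _ _ /eqP; rewrite mulf_eq0 invr_eq0 sqrf_eq0 (negPf b0) (negPf d0).
split; split; try ring.
  by field.
(* The factor b^3 is isolated so that [bd] applies; both sides then equal d^5 / b^2. *)
have -> : b ^+ 2 * (d ^+ 2 / b) = b ^+ 3 * (d ^+ 2 / b ^+ 2) by field.
by rewrite bd; field.
Qed.

End EntrywiseSystem.

Theorem proposition6p2 (R : realType) (K : fieldType)
    (hK : K = R :> fieldType \/ K = R[i]%C :> fieldType) (a b c d : K) :
  (a = 0 -> b <> 0 -> c <> 0 -> d <> 0 ->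
     forall X : 'M[K]_2,
       (is_solution (mx2 a 0 0 b) (mx2 c 0 0 d) X /\ X <> 0) <->
       (b ^+ 3 = d ^+ 3 /\ X = mx2 0 0 0 (d ^+ 2 / b))) /\
  (b = 0 -> a <> 0 -> c <> 0 -> d <> 0 ->
     forall X : 'M[K]_2,
       (is_solution (mx2 a 0 0 b) (mx2 c 0 0 d) X /\ X <> 0) <->
       (a ^+ 3 = c ^+ 3 /\ X = mx2 (c ^+ 2 / a) 0 0 0)).
Proof.
split=> [-> | ->] /eqP h /eqP c0 /eqP d0 X; rewrite (mx2_entries X) mx2_0.
  by rewrite is_solution_mx2P !mx2_eqP; exact: entry_systems_solution.
rewrite is_solution_mx2P !mx2_eqP.
(* The coordinates are exchanged: [a] takes the place of [b], and [c], [d] trade places. *)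
have := entry_systems_solution (X 1 1) (X 1 0) (X 0 1) (X 0 0) h d0 c0.
have revP (P Q S T : Prop) : [/\ P, Q, S & T] <-> [/\ T, S, Q & P].
  by split=> -[].
(* Fixing the first conjunct as a condition on [X 0 0] keeps the repeated reversal from undoing
   itself. *)
by rewrite (entry_system_swap a) (entry_system_swap c) !(revP (X 0 0 = _)).
Qed.
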